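(* Let $n\ge 1$. Every $2$-local $\frac12$-derivation of the complex Lie algebra $\mathfrak{L}_n$ is a $\frac12$-derivation.
   Context: All algebras are over $\mathbb{C}$. A linear map $D:\mathfrak{L}\to\mathfrak{L}$ on a Lie algebra is a $\frac12$-derivation if $D[x,y]=\frac12\big([D(x),y]+[x,D(y)]\big)$ for all $x,y\in\mathfrak{L}$. A map $\nabla:\mathfrak{L}\to\mathfrak{L}$ (not necessarily linear) is a $2$-local $\frac12$-derivation if for all $x,y\in\mathfrak{L}$ there is a $\frac12$-derivation $D_{x,y}$ with $\nabla(x)=D_{x,y}(x)$ and $\nabla(y)=D_{x,y}(y)$. $\mathfrak{L}_n$ is the $2n$-dimensional solvable Lie algebra with basis $\{e_1,\dots,e_n,x_1,\dots,x_n\}$ and brackets $[e_i,x_i]=e_i$ for $1\le i\le n$; brackets of basis elements not obtained from these by antisymmetry are zero. (Its nilradical is the abelian ideal spanned by $e_1,\dots,e_n$.) *)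

(* Defs.v *)
From HB Require Import structures.
From mathcomp Require Import all_boot all_order all_algebra.
From mathcomp Require Import all_classical all_reals.
From mathcomp Require Import complex ring.

Set Implicit Arguments.
Unset Strict Implicit.
Unset Printing Implicit Defensive.

Import Order.TTheory GRing.Theory Num.Theory.
Local Open Scope ring_scope.

HB.mixin Record Lmodule_isLieAlgebra (K : numFieldType) L
    of GRing.Lmodule K L := {
  lie_bracket : L -> L -> L;
  lie_bracketDl : forall (a : K) (x y z : L),
    lie_bracket (a *: x + y) z = a *: lie_bracket x z + lie_bracket y z;
  lie_bracketDr : forall (a : K) (x y z : L),
    lie_bracket z (a *: x + y) = a *: lie_bracket z x + lie_bracket z y;
  lie_bracketxx : forall x : L, lie_bracket x x = 0;
  lie_jacobi : forall x y z : L,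
    lie_bracket x (lie_bracket y z) + lie_bracket y (lie_bracket z x)
      + lie_bracket z (lie_bracket x y) = 0
}.

#[short(type="lieAlgType")]
HB.structure Definition LieAlgebra (K : numFieldType) :=
  { L of GRing.Lmodule K L & Lmodule_isLieAlgebra K L }.

Notation "[lie x , y ]" := (lie_bracket x y)
  (at level 0, x, y at level 99, format "[lie  x ,  y ]") : ring_scope.

Definition half_derivation (K : numFieldType) (L : lieAlgType K)
    (D : L -> L) : Prop :=
  linear D /\
  forall x y : L, D [lie x, y] = 2^-1 *: ([lie D x, y] + [lie x, D y]).

Definition two_local_half_derivation (K : numFieldType) (L : lieAlgType K)
    (nabla : L -> L) : Prop :=
  forall x y : L, exists D : L -> L,
    [/\ half_derivation D, nabla x = D x & nabla y = D y].

(* Coordinates 0, ..., n-1 are along e_1, ..., e_n and coordinates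
   n, ..., 2n-1 are along x_1, ..., x_n. *)
Definition solvLie (K : numFieldType) (n : nat) : Type := 'rV[K]_(n + n).

HB.instance Definition _ (K : numFieldType) (n : nat) :=
  GRing.Lmodule.copy (solvLie K n) 'rV[K]_(n + n).

Section SolvLie.
Variables (K : numFieldType) (n : nat).
Local Notation L := (solvLie K n).

Definition solv_e (i : 'I_n) : L := delta_mx 0 (lshift n i).
Definition solv_x (i : 'I_n) : L := delta_mx 0 (rshift n i).

Lemma solv_basisE (u : L) :
  u = \sum_(i < n) u 0 (lshift n i) *: solv_e i
    + \sum_(i < n) u 0 (rshift n i) *: solv_x i.
Proof. by rewrite {1}[u]row_sum_delta big_split_ord. Qed.

(* The bilinear alternating extension of [e_i, x_i] = e_i, all other brackets
   of basis elements (up to antisymmetry) being zero; see solv_bracket_ex,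
   solv_bracket_ee and solv_bracket_xx. *)
Definition solv_bracket (u v : L) : L :=
  \sum_(i < n) (u 0 (lshift n i) * v 0 (rshift n i)
                - u 0 (rshift n i) * v 0 (lshift n i)) *: solv_e i.

Lemma solv_bracketE_l (u v : L) (i : 'I_n) :
  solv_bracket u v 0 (lshift n i) =
  u 0 (lshift n i) * v 0 (rshift n i) - u 0 (rshift n i) * v 0 (lshift n i).
Proof.
rewrite /solv_bracket summxE (bigD1 i) //= big1 => [|j ji].
  by rewrite !mxE !eqxx mulr1 addr0.
by rewrite !mxE eqxx (inj_eq (@lshift_inj _ _)) eq_sym (negbTE ji) mulr0.
Qed.

Lemma solv_bracketE_r (u v : L) (i : 'I_n) :
  solv_bracket u v 0 (rshift n i) = 0.
Proof.
rewrite /solv_bracket summxE big1 // => j _.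
by rewrite !mxE eqxx eq_rlshift mulr0.
Qed.

Lemma solv_ext (u v : L) :
  (forall i, u 0 (lshift n i) = v 0 (lshift n i)) ->
  (forall i, u 0 (rshift n i) = v 0 (rshift n i)) -> u = v.
Proof.
move=> hl hr; apply/rowP => k; case: (splitP k) => j kj.
  by have -> : k = lshift n j by exact: val_inj.
by have -> : k = rshift n j by exact: val_inj.
Qed.

Fact solv_bracketDl (a : K) (x y z : L) :
  solv_bracket (a *: x + y) z = a *: solv_bracket x z + solv_bracket y z.
Proof.
apply: solv_ext => i; rewrite !mxE ?solv_bracketE_l ?solv_bracketE_r ?mxE.
  by rewrite !mulrDl mulrBr !mulrA opprD addrACA.
by rewrite mulr0 addr0.
Qed.

Fact solv_bracketDr (a : K) (x y z : L) :
  solv_bracket z (a *: x + y) = a *: solv_bracket z x + solv_bracket z y.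
Proof.
apply: solv_ext => i; rewrite !mxE ?solv_bracketE_l ?solv_bracketE_r ?mxE.
  by rewrite !mulrDr mulrN opprD addrACA !(mulrCA a).
by rewrite mulr0 addr0.
Qed.

Fact solv_bracketxx (x : L) : solv_bracket x x = 0.
Proof.
by apply: solv_ext => i; rewrite !mxE ?solv_bracketE_l ?solv_bracketE_r //
  mulrC subrr.
Qed.

Fact solv_jacobi (x y z : L) :
  solv_bracket x (solv_bracket y z) + solv_bracket y (solv_bracket z x)
    + solv_bracket z (solv_bracket x y) = 0.
Proof.
apply: solv_ext => i; rewrite !mxE ?solv_bracketE_l ?solv_bracketE_r ?addr0 //.
by rewrite !mulr0 !sub0r; ring.
Qed.

HB.instance Definition _ := Lmodule_isLieAlgebra.Build K L
  solv_bracketDl solv_bracketDr solv_bracketxx solv_jacobi.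

Lemma solv_bracket_ex (i j : 'I_n) :
  [lie solv_e i, solv_x j] = if i == j then solv_e i else 0.
Proof.
apply: solv_ext => k; rewrite /lie_bracket /= ?solv_bracketE_l ?solv_bracketE_r;
  case: (eqVneq i j) => [->|ij];
  rewrite !mxE ?eqxx ?eq_lrshift ?eq_rlshift ?andbF //=
    ?(inj_eq (@lshift_inj _ _)) ?(inj_eq (@rshift_inj _ _)) ?mul0r ?subr0.
  by case: eqP => _; rewrite ?mulr0 ?mulr1.
by case: (eqVneq k i) => [->|_]; rewrite ?mul0r // (negbTE ij) mulr0.
Qed.

Lemma solv_bracket_ee (i j : 'I_n) : [lie solv_e i, solv_e j] = 0.
Proof.
by apply: solv_ext => k; rewrite /lie_bracket /=
  ?solv_bracketE_l ?solv_bracketE_r !mxE ?eq_rlshift ?andbF ?mulr0 ?mul0r ?subr0.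
Qed.

Lemma solv_bracket_xx (i j : 'I_n) : [lie solv_x i, solv_x j] = 0.
Proof.
by apply: solv_ext => k; rewrite /lie_bracket /=
  ?solv_bracketE_l ?solv_bracketE_r !mxE ?eq_lrshift ?andbF ?mulr0 ?mul0r ?subr0.
Qed.

End SolvLie.

(* Main.v *)
Require Import Defs.
From HB Require Import structures.
From mathcomp Require Import all_boot all_order all_algebra.
From mathcomp Require Import all_classical all_reals.
From mathcomp Require Import complex.

Import Order.TTheory GRing.Theory Num.Theory.
Local Open Scope ring_scope.

(** A half-derivation of the algebra with brackets [e_i, x_i] = e_i is
determined by its value at the single vector v = x_1 + ... + x_n
([half_derivation_solv_eq]).  Comparing a 2-local half-derivation nabla, at
each pair (u, v), with the half-derivation that serves the pair, one finds
that all these half-derivations take the value nabla v at v; hence they are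
one and the same map, and nabla is that map
([two_local_half_derivation_separating]).

Since half-derivations form a vector space, the determination by the value at
v amounts to: a half-derivation D with D v = 0 is zero.  Bracketing with v on
the right is the projection P onto the span of the e_i along the span of the
x_i, so that the half-Leibniz rule for [y, v] reads D (P y) = (P (D y)) / 2.
In particular D (P y) is fixed by P; replacing y with P y in the rule gives
D (P y) = (P (D (P y))) / 2 = (D (P y)) / 2, hence D (P y) = 0 and then
P (D y) = 0.  The latter says that D y has no e_i-coordinates.  By the former,
D kills every e_i and every bracket, so the rule for [e_i, y] leaves
[e_i, D y] = 0, which says that D y has no x_i-coordinate. *)

(** * Half-derivations of a Lie algebra *)

Section HalfDerivation.
Context {K : numFieldType} {L : lieAlgType K}.
Implicit Types (x y z : L) (D nabla : L -> L).

Lemma lie_bracketBl x y z : [lie x - y, z] = [lie x, z] - [lie y, z].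
Proof. by rewrite [x - y]addrC -scaleN1r lie_bracketDl scaleN1r addrC. Qed.

Lemma lie_bracketBr x y z : [lie z, x - y] = [lie z, x] - [lie z, y].
Proof. by rewrite [x - y]addrC -scaleN1r lie_bracketDr scaleN1r addrC. Qed.

Lemma lie_bracket0l z : [lie 0, z] = 0.
Proof. by have := lie_bracketBl 0 0 z; rewrite !subrr. Qed.

Lemma lie_bracket0r z : [lie z, 0] = 0.
Proof. by have := lie_bracketBr 0 0 z; rewrite !subrr. Qed.

Lemma half_derivationB D1 D2 :
  half_derivation D1 -> half_derivation D2 ->
  half_derivation (fun x => D1 x - D2 x).
Proof.
move=> [lin1 der1] [lin2 der2]; split=> [a x y|x y].
  by rewrite lin1 lin2 scalerBr opprD addrACA.
by rewrite der1 der2 lie_bracketBl lie_bracketBr -scalerBr opprD addrACA.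
Qed.

(** A vector v at which half-derivations are separated forces locality to be
global: the half-derivations attached to the pairs (u, v) and (v, v) agree at
v, hence also at u. *)
Lemma two_local_half_derivation_separating (v : L) nabla :
  (forall D1 D2, half_derivation D1 -> half_derivation D2 ->
    D1 v = D2 v -> D1 =1 D2) ->
  two_local_half_derivation nabla -> half_derivation nabla.
Proof.
move=> sep loc; have [D [hD nablavD _]] := loc v v.
suff -> : nabla = D by [].
apply/funext => u; have [D' [hD' -> nablavD']] := loc u v.
by apply: sep; rewrite // -nablavD' nablavD.
Qed.

End HalfDerivation.

(** * Half-derivations of the solvable algebra *)

Section SolvLie.
Context {K : numFieldType} {n : nat}.
Local Notation L := (solvLie K n).
Implicit Types (u y z : L) (D : L -> L).

Lemma solv_lieE_l (u y : L) (i : 'I_n) :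
  [lie u, y] 0 (lshift n i) =
  u 0 (lshift n i) * y 0 (rshift n i) - u 0 (rshift n i) * y 0 (lshift n i).
Proof. exact: solv_bracketE_l. Qed.

Lemma solv_lieE_r (u y : L) (i : 'I_n) : [lie u, y] 0 (rshift n i) = 0.
Proof. exact: solv_bracketE_r. Qed.

Definition solv_x_sum : L := row_mx 0 (const_mx 1).
Local Notation v := solv_x_sum.

(** Bracketing with the sum of the x_i is the projection onto the span of the
e_i along the span of the x_i. *)
Lemma solv_lie_x_sumE_l u (i : 'I_n) :
  [lie u, v] 0 (lshift n i) = u 0 (lshift n i).
Proof. by rewrite solv_lieE_l row_mxEl row_mxEr !mxE mulr1 mulr0 subr0. Qed.

Lemma solv_lie_x_sum_id u :
  (forall i, u 0 (rshift n i) = 0) -> [lie u, v] = u.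
Proof.
move=> u0; apply: solv_ext => i; first exact: solv_lie_x_sumE_l.
by rewrite solv_lieE_r u0.
Qed.

Lemma solv_lie_lie_x_sum u y : [lie [lie u, y], v] = [lie u, y].
Proof. by apply: solv_lie_x_sum_id => i; rewrite solv_lieE_r. Qed.

Lemma solv_lie_e_x_sum (i : 'I_n) : [lie solv_e K i, v] = solv_e K i.
Proof.
by apply: solv_lie_x_sum_id => j; rewrite mxE eq_rlshift andbF.
Qed.

Section VanishingAtXSum.
Variable D : L -> L.
Hypotheses (hD : half_derivation D) (Dv0 : D v = 0).

Let D_lie_v y : D [lie y, v] = 2^-1 *: [lie D y, v].
Proof. by rewrite hD.2 Dv0 lie_bracket0r addr0. Qed.

(** The value z = D [y, v] satisfies z = z / 2: it is its own bracket with v,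
as is [y, v], to which the rule applies once more. *)
Lemma half_derivation_lie_x_sum_eq0 y : D [lie y, v] = 0.
Proof.
set z := D _.
have Pz : [lie z, v] = z.
  apply: solv_lie_x_sum_id => i.
  by rewrite /z D_lie_v mxE solv_lieE_r mulr0.
have zE : z = 2^-1 *: z by rewrite -{2}Pz -D_lie_v solv_lie_lie_x_sum.
apply/eqP; have /eqP : (1 - 2^-1) *: z = 0.
  by rewrite scalerBl scale1r -zE subrr.
by rewrite scaler_eq0 subr_eq0 eq_sym invr_eq1 pnatr_eq1.
Qed.

Lemma half_derivation_solv_eq0 y : D y = 0.
Proof.
have half_neq0 : 2^-1 != 0 :> K by rewrite invr_eq0 pnatr_eq0.
have D_lie u w : D [lie u, w] = 0.
  by rewrite -solv_lie_lie_x_sum half_derivation_lie_x_sum_eq0.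
have PDy : [lie D y, v] = 0.
  apply/eqP; have /eqP := D_lie_v y.
  by rewrite D_lie eq_sym scaler_eq0 (negbTE half_neq0).
apply: solv_ext => i; first by rewrite -solv_lie_x_sumE_l PDy.
have De : D (solv_e K i) = 0 by rewrite -solv_lie_e_x_sum D_lie.
have eDy : [lie solv_e K i, D y] = 0.
  apply/eqP; have /eqP := hD.2 (solv_e K i) y.
  by rewrite D_lie De lie_bracket0l add0r eq_sym scaler_eq0 (negbTE half_neq0).
have := solv_lieE_l (solv_e K i) (D y) i.
by rewrite eDy !mxE !eqxx eq_rlshift andbF mul1r mul0r subr0 => <-.
Qed.

End VanishingAtXSum.

Lemma half_derivation_solv_eq D1 D2 :
  half_derivation D1 -> half_derivation D2 -> D1 v = D2 v -> D1 =1 D2.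
Proof.
move=> h1 h2 D12 y; apply/eqP; rewrite -subr_eq0; apply/eqP.
by apply: (half_derivation_solv_eq0 _ (half_derivationB _ _ h1 h2));
  rewrite D12 subrr.
Qed.

End SolvLie.

Theorem theorem16 (R : realType) (n : nat) (hn : (0 < n)%N)
    (nabla : solvLie R[i] n -> solvLie R[i] n)
    (hnabla : two_local_half_derivation nabla) :
  half_derivation nabla.
Proof.
exact: (two_local_half_derivation_separating _ _ half_derivation_solv_eq).
Qed.
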